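(* Fix $\sigma>1$ and let $\varphi_\sigma:[0,\infty)\to[0,\infty)$ be given by $\varphi_\sigma(t)=\dfrac{t^{\frac{\sigma}{\sigma-1}}}{W(t)^{\frac{1}{\sigma-1}}}$ for $t>0$ and $\varphi_\sigma(0)=0$, where $W$ is the restriction to $[0,\infty)$ of the principal branch of the Lambert $W$ function. For $\tau,h>0$ let $$T_{\tau,\sigma,h}(k)=\sup_{p\in\mathbf N}\ln_+\frac{h^{p^\sigma}k^p}{M_p^{\tau,\sigma}},\quad k>0,\qquad M_p^{\tau,\sigma}=p^{\tau p^\sigma}\ (p\ge 1),\quad M_0^{\tau,\sigma}=1 .$$ Then the following hold. (i) The function $\omega(k)=\varphi_\sigma(\ln_+|k|)$, $k\in\mathbf R$, is equivalent to a weight function. Moreover, for every $h>0$ and every $\tau>0$, the function $\omega(k)=T_{\tau,\sigma,h}(|k|)$, $k\in\mathbf R$, is equivalent to a weight function. (ii) The weight matrices $\mathcal M_\sigma=\{(M_p^{\tau,\sigma})_{p\in\mathbf N}\}_{\tau>0}$ and $\mathcal N_\sigma=\{(e^{\frac1H\varphi_\sigma^*(Hp)})_{p\in\mathbf N}\}_{H>0}$ are equivalent. In particular, for every open set $U\subseteq\mathbf R^d$, $$\mathcal B_{(\sigma)}(U)=\mathcal E_{(\sigma)}^B(U),\qquad \mathcal B_{\{\sigma\}}(U)=\mathcal E_{\{\sigma\}}^R(U).$$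
   Context: $\mathbf N$ denotes the nonnegative integers. $\ln_+x=\max\{0,\ln x\}$ for $x>0$, and $\ln_+0=0$; accordingly $T_{\tau,\sigma,h}(0)=0$. $W(x)$, $x\ge0$, is the inverse of $x\mapsto xe^x$ on $[0,\infty)$. Weight function: a non-negative, continuous, even function $\omega$ on $\mathbf R$, increasing (in the non-strict sense) on $[0,\infty)$, with $\omega(0)=0$, such that ($\alpha$) $\omega(2t)=O(\omega(t))$ as $t\to\infty$; ($\beta$) $\omega(t)=O(t)$ as $t\to\infty$; ($\gamma$) $\log t=o(\omega(t))$ as $t\to\infty$; ($\delta$) $\varphi(t)=\omega(e^t)$ is convex. Functions $f,g$ are equivalent if $f=O(g)$ and $g=O(f)$ (at infinity). Young conjugate: $\varphi_\sigma^*(k)=\sup_{t>0}(kt-\varphi_\sigma(t))$, $k\ge0$. A weight matrix is a family of weight sequences (in particular, positive sequences with $M_p^{1/p}\to\infty$) such that for any two members $(M_p)$, $(N_p)$ either $M_p\le N_p$ for all $p\in\mathbf N$ or $N_p\le M_p$ for all $p\in\mathbf N$. For weight matrices write $\mathcal M\lesssim\mathcal N$ if for every $(M_p)\in\mathcal M$ there exist $(N_p)\in\mathcal N$ and $C>0$ with $M_p\le C^pN_p$ for all $p\in\mathbf N$. $\mathcal M$ and $\mathcal N$ are equivalent if $\mathcal M\lesssim\mathcal N$ and $\mathcal N\lesssim\mathcal M$. Spaces: let $U\subseteq\mathbf R^d$ be open; $K\subset\subset U$ denotes a regular compact subset of $U$. For $\tau,H>0$ let $\mathcal E_{\tau,\sigma,1}(K)$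 and $\mathcal B_{H,\sigma}(K)$ be the Banach spaces of $\phi\in C^\infty(K)$ for which, respectively, $$\|\phi\|_{\mathcal E_{\tau,\sigma,1}(K)}=\sup_{\alpha\in\mathbf N^d}\sup_{x\in K}\frac{|\partial^\alpha\phi(x)|}{M_{|\alpha|}^{\tau,\sigma}}<\infty,\qquad \|\phi\|_{\mathcal B_{H,\sigma}(K)}=\sup_{\alpha\in\mathbf N^d}\sup_{x\in K}|\partial^\alpha\phi(x)|\,e^{-\frac1H\varphi_\sigma^*(H|\alpha|)}<\infty .$$ Define $$\mathcal E_{\{\sigma\}}^R(U)=\varprojlim_{K\subset\subset U}\varinjlim_{\tau\to\infty}\mathcal E_{\tau,\sigma,1}(K),\qquad \mathcal E_{(\sigma)}^B(U)=\varprojlim_{K\subset\subset U}\varprojlim_{\tau\to0}\mathcal E_{\tau,\sigma,1}(K),$$ $$\mathcal B_{\{\sigma\}}(U)=\varprojlim_{K\subset\subset U}\varinjlim_{H\to\infty}\mathcal B_{H,\sigma}(K),\qquad \mathcal B_{(\sigma)}(U)=\varprojlim_{K\subset\subset U}\varprojlim_{H\to0}\mathcal B_{H,\sigma}(K).$$ Thus $\phi\in C^\infty(U)$ belongs to $\mathcal E_{\{\sigma\}}^R(U)$ (resp. $\mathcal E_{(\sigma)}^B(U)$) iff for every $K\subset\subset U$ the norm $\|\phi\|_{\mathcal E_{\tau,\sigma,1}(K)}$ is finite for some $\tau>0$ (resp. for every $\tau>0$), and to $\mathcal B_{\{\sigma\}}(U)$ (resp. $\mathcal B_{(\sigma)}(U)$)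 iff for every $K\subset\subset U$ the norm $\|\phi\|_{\mathcal B_{H,\sigma}(K)}$ is finite for some $H>0$ (resp. for every $H>0$). *)

(* Defs.v *)
From HB Require Import structures.
From mathcomp Require Import all_boot all_order all_algebra.
From mathcomp Require Import all_classical all_reals all_analysis.
From mathcomp Require Import complex.

Set Implicit Arguments.
Unset Strict Implicit.
Unset Printing Implicit Defensive.

Import Order.TTheory GRing.Theory Num.Theory.
Import numFieldNormedType.Exports.

Local Open Scope classical_set_scope.
Local Open Scope ring_scope.
Local Open Scope complex_scope.

Local Notation normc := ComplexField.Normc.normc.

Section WeightFunctions.
Context {R : realType}.

(* Only the values at [0 <= x] are meaningful. *)
Definition lambertW (x : R) : R := xget 0 [set y | 0 <= y /\ y * expR y = x].

Definition phi (sigma t : R) : R :=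
  if 0 < t then t `^ (sigma / (sigma - 1)) / lambertW t `^ (1 / (sigma - 1))
  else 0.

Definition ln_plus (x : R) : R := if 0 < x then Num.max 0 (ln x) else 0.

Definition Mseq (tau sigma : R) (p : nat) : R :=
  if p == 0%N then 1 else p%:R `^ (tau * p%:R `^ sigma).

(* The real-valued [sup] is 0 on unbounded sets; for [1 < sigma] the sets below
   are bounded above. *)
Definition Tfun (tau sigma h k : R) : R :=
  sup [set ln_plus (h `^ (p%:R `^ sigma) * k ^+ p / Mseq tau sigma p)
      | p in [set: nat]].

Definition young_conj (f : R -> R) (k : R) : R :=
  sup [set k * t - f t | t in [set t | 0 < t]].

Definition Nseq (H sigma : R) (p : nat) : R :=
  expR (H^-1 * young_conj (phi sigma) (H * p%:R)).

Canonical pinfty_filter_on : filter_on R :=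
  FilterType (pinfty_nbhs R) (@proper_pinfty_nbhs R).

Local Notation infty := (pinfty_nbhs R).

Definition weight_function (w : R -> R) : Prop :=
  [/\ forall t, 0 <= w t,
      continuous w,
      forall t, w (- t) = w t,
      forall s t, 0 <= s -> s <= t -> w s <= w t
    & w 0 = 0] /\
  [/\ (fun t : R => w (2 * t)) =O_infty w,
      w =O_infty (fun t : R => t),
      (fun t : R => ln t) =o_infty w
    & convex_function [set: R] (fun t : R => w (expR t))].

(* Only applied to even functions, for which "at infinity" is at [+oo]. *)
Definition equiv_fun (f g : R -> R) : Prop := f =O_infty g /\ g =O_infty f.

Definition equivalent_to_weight_function (f : R -> R) : Prop :=
  exists w : R -> R, weight_function w /\ equiv_fun f w.

End WeightFunctions.

Section WeightMatrices.
Context {R : realType}.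

(* Only positivity and the growth of the roots are required; in particular
   log-convexity is not. *)
Definition weight_sequence (M : nat -> R) : Prop :=
  (forall p, 0 < M p) /\ M p `^ (p%:R^-1) @[p --> \oo] --> +oo.

Definition weight_matrix (MM : set (nat -> R)) : Prop :=
  MM `<=` weight_sequence /\
  forall M N, MM M -> MM N ->
    (forall p, M p <= N p) \/ (forall p, N p <= M p).

Definition matrix_le (MM NN : set (nat -> R)) : Prop :=
  forall M, MM M -> exists N (C : R),
    [/\ NN N, 0 < C & forall p : nat, M p <= C ^+ p * N p].

Definition matrix_equiv (MM NN : set (nat -> R)) : Prop :=
  matrix_le MM NN /\ matrix_le NN MM.

Definition Mmatrix (sigma : R) : set (nat -> R) :=
  [set Mseq tau sigma | tau in [set tau | 0 < tau]].

Definition Nmatrix (sigma : R) : set (nat -> R) :=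
  [set Nseq H sigma | H in [set H | 0 < H]].

End WeightMatrices.

Section LocallyConvexSpaces.
Context {R : realType} {X : Type}.
Implicit Types (F G : X -> R[i]).

(* A locally convex space whose elements are functions [X -> R[i]], with
   pointwise operations.  [nbhs0 E] is the filter, on all of [X -> R[i]],
   generated by the neighbourhoods of 0 in [carrier E]. *)
Record lcs := Lcs {
  carrier : set (X -> R[i]);
  nbhs0 : set_system (X -> R[i]) }.

Definition normed_lcs (A : set (X -> R[i])) (N : (X -> R[i]) -> \bar R) : lcs :=
  let B := A `&` [set F | (N F < +oo)%E] in
  Lcs B (filter_from [set e : R | 0 < e]
           (fun e => B `&` [set F | (N F < e%:E)%E])).

Definition absolutely_convex (V : set (X -> R[i])) : Prop :=
  forall (a b : R[i]) F G, normc a + normc b <= 1 -> V F -> V G ->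
    V (fun x => a * F x + b * G x).

(* The union (in our case, an increasing one) with the finest locally convex topology for which all
   the inclusions are continuous. *)
Definition indlim (I : Type) (D : set I) (E : I -> lcs) : lcs :=
  Lcs (\bigcup_(i in D) carrier (E i))
      [set W | exists2 V, absolutely_convex V &
                 V `<=` W /\ forall i, D i -> nbhs0 (E i) V].

(* Projective limit of the [E i] along the maps [A -> E i] which send a
   function to itself (or to its restriction, see [DK]), inside an ambient
   space [A]: it carries the coarsest topology making these continuous. *)
Definition projlim (A : set (X -> R[i])) (I : Type) (D : set I)
    (E : I -> lcs) : lcs :=
  let B := A `&` \bigcap_(i in D) carrier (E i) in
  Lcs B (smallest (fun F : set_system (X -> R[i]) => Filter F)
           (B |` \bigcup_(i in D) nbhs0 (E i))).

End LocallyConvexSpaces.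
Arguments lcs : clear implicits.

Section SmoothFunctions.
Context {R : realType} {d : nat}.
Local Notation Rd := 'rV[R]_d.
Implicit Types (U K : set Rd) (u : Rd -> R) (f : Rd -> R[i]).

Definition partial (i : 'I_d) u : Rd -> R := 'D_(delta_mx 0 i : Rd) u.

Definition partials (s : seq 'I_d) u : Rd -> R := foldr partial u s.

Definition multiindex := {ffun 'I_d -> nat}.

Definition msize (a : multiindex) : nat := (\sum_(i < d) a i)%N.

Definition mpartial (a : multiindex) u : Rd -> R :=
  partials (flatten [seq nseq (a i) i | i <- enum 'I_d]) u.

(* For [U] open only the values on [U] matter, so that a function on [U] is
   represented by any of its extensions to [Rd]. *)
Definition smooth_real U u : Prop :=
  forall (s : seq 'I_d) x, U x ->
    {for x, continuous (partials s u)} /\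
    forall i, derivable (partials s u) x (delta_mx 0 i : Rd).

Definition Cinfty U : set (Rd -> R[i]) :=
  [set f | smooth_real U (fun x => complex.Re (f x)) /\
           smooth_real U (fun x => complex.Im (f x))].

Definition regular_compact K : Prop :=
  compact K /\ closure (interior K) = K.

(* The space of functions smooth in the interior of [K] all of whose partial
   derivatives extend continuously to [K]; only the values on [K] matter. *)
Definition smoothK_real K u : Prop :=
  [/\ smooth_real (interior K) u,
      {within K, continuous u}
    & forall a : multiindex, exists v : Rd -> R,
        {within K, continuous v} /\
        forall x, interior K x -> v x = mpartial a u x].

Definition CinftyK K : set (Rd -> R[i]) :=
  [set f | smoothK_real K (fun x => complex.Re (f x)) /\
           smoothK_real K (fun x => complex.Im (f x))].

(* The continuous extension to [K] of the derivative in the interior; it is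
   the derivative itself if [u] is smooth around [K]. *)
Definition DK_real K (a : multiindex) u (x : Rd) : R :=
  lim (mpartial a u y @[y --> within (interior K) (nbhs x)]).

Definition DK K (a : multiindex) f (x : Rd) : R[i] :=
  DK_real K a (fun y => complex.Re (f y)) x +i*
  DK_real K a (fun y => complex.Im (f y)) x.

(* If [K] is empty this is [-oo] and not 0, which does not affect the space
   obtained from it by [normed_lcs]. *)
Definition weighted_norm K (c : nat -> R) f : \bar R :=
  ereal_sup
    [set (normc (DK K ax.1 f ax.2) * c (msize ax.1))%:E
    | ax in [set ax : multiindex * Rd | K ax.2]].

Definition Enorm (tau sigma : R) K : (Rd -> R[i]) -> \bar R :=
  weighted_norm K (fun n => (Mseq tau sigma n)^-1).

Definition Bnorm (H sigma : R) K : (Rd -> R[i]) -> \bar R :=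
  weighted_norm K
    (fun n => expR (- (H^-1 * young_conj (phi sigma) (H * n%:R)))).

Definition EK (sigma : R) K (tau : R) : lcs R Rd :=
  normed_lcs (CinftyK K) (Enorm tau sigma K).

Definition BK (sigma : R) K (H : R) : lcs R Rd :=
  normed_lcs (CinftyK K) (Bnorm H sigma K).

Definition regular_compacts_in U : set (set Rd) :=
  [set K | regular_compact K /\ K `<=` U].

Definition positive : set R := [set t | 0 < t].

Definition E_roumieu (sigma : R) U : lcs R Rd :=
  projlim (Cinfty U) (regular_compacts_in U)
    (fun K => indlim positive (EK sigma K)).

Definition E_beurling (sigma : R) U : lcs R Rd :=
  projlim (Cinfty U) (regular_compacts_in U)
    (fun K => projlim (CinftyK K) positive (EK sigma K)).

Definition B_roumieu (sigma : R) U : lcs R Rd :=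
  projlim (Cinfty U) (regular_compacts_in U)
    (fun K => indlim positive (BK sigma K)).

Definition B_beurling (sigma : R) U : lcs R Rd :=
  projlim (Cinfty U) (regular_compacts_in U)
    (fun K => projlim (CinftyK K) positive (BK sigma K)).

End SmoothFunctions.

(* Main.v *)
Require Import Defs.
From mathcomp Require Import all_boot all_order all_algebra.
From mathcomp Require Import all_classical all_reals all_analysis.
From mathcomp Require Import complex ring lra.

Set Implicit Arguments.
Unset Strict Implicit.
Unset Printing Implicit Defensive.

Import Order.TTheory GRing.Theory Num.Theory.
Import numFieldNormedType.Exports.
Local Open Scope classical_set_scope.
Local Open Scope ring_scope.

(** Put [a = sigma - 1], [b = 1 / a] and [W] = [lambertW].  Since
    [t / W(t) = e^(W(t))], the weight is [phi t = t e^(b W(t))].  With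
    [L = ln k], the logarithm of the [p]-th term of [T] is
    [p (L - p^a (tau ln p - ln h))], whose sign changes at [p] of order
    [e^(b W(L))]: there [p^a ln p] is of order [e^(W(L)) W(L) = L].  Hence [T]
    is of order [L e^(b W(L)) = phi L].  Similarly the supremum defining
    [phi^*(H p)] is governed by the points [t] where [e^(b W(t))] is of order
    [H p], that is [t] of order [(H p)^a ln p], so that [phi^*(H p) / H] is of
    order [H^a p^sigma ln p], the logarithm of [M_p] with [tau] of order [H^a].
    The resulting bounds [M <= C N] and [N <= C M] have constants independent of
    [p], so they give continuous inclusions between the normed spaces,
    and these pass to the inductive and projective limits. *)

(** * The Lambert function on the half-line: monotonicity, Lipschitz continuity, scaling *)

Section LambertW.
Context {R : realType}.
Implicit Types x y : R.

Lemma expR_ge1 x : 0 <= x -> 1 <= expR x.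
Proof. by have := expR_ge1Dx x; lra. Qed.

(** Since [y e^y] expands distances on [[0, +oo)], this one inequality gives its injectivity and
    shows that its inverse is monotone and 1-Lipschitz. *)
Lemma mul_expR_sub_ge x y : 0 <= y -> y <= x -> x - y <= x * expR x - y * expR y.
Proof.
move=> y0 yx.
have e1 : expR y <= expR x by rewrite ler_expR.
have e2 : 1 <= expR y by exact: expR_ge1.
have -> : x * expR x - y * expR y = x * (expR x - expR y) + (x - y) * expR y by ring.
apply: (@le_trans _ _ ((x - y) * expR y)).
  by rewrite ler_peMr// subr_ge0.
by rewrite lerDr mulr_ge0// ?subr_ge0// (le_trans y0).
Qed.

Lemma mul_expR_surj x : 0 <= x -> exists y, 0 <= y /\ y * expR y = x.
Proof.
move=> x0.
have [||y] := @IVT R (fun y => y * expR y) 0 x x x0.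
- apply: continuous_subspaceT => y.
  by apply: continuousM; [exact: cvg_id|exact: continuous_expR].
- rewrite mul0r ge_min x0 /= le_max ler_peMr ?orbT//.
  exact: expR_ge1.
- by rewrite in_itv /= => /andP[y0 _] yx; exists y.
Qed.

Lemma lambertW_ge0 x : 0 <= lambertW x.
Proof. by rewrite /lambertW; case: xgetP => // y _ []. Qed.

Lemma lambertWK x : 0 <= x -> lambertW x * expR (lambertW x) = x.
Proof.
move=> x0; rewrite /lambertW; case: xgetP => [y _ []//|nex].
by have [y yP] := mul_expR_surj x0; case: (nex y).
Qed.

Lemma lambertW_mul_expR y : 0 <= y -> lambertW (y * expR y) = y.
Proof.
move=> y0; have x0 : 0 <= y * expR y by rewrite mulr_ge0 ?expR_ge0.
have := lambertWK x0; have := lambertW_ge0 (y * expR y).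
move: (lambertW _) => z z0 zy.
by case: (leP z y) => [zy'|/ltW yz]; [have := mul_expR_sub_ge z0 zy'|
  have := mul_expR_sub_ge y0 yz]; lra.
Qed.

(** A negative [x] has no preimage, so [xget] returns its default 0; for [x = 0] the only preimage
    is 0. With this value [lambertW] is monotone and continuous on the whole line. *)
Lemma lambertW_neg x : x <= 0 -> lambertW x = 0.
Proof.
move=> x0; rewrite /lambertW; case: xgetP => // y _ [y0 yx].
have := @mul_expR_sub_ge y 0 (lexx 0) y0; rewrite mul0r; lra.
Qed.

Lemma lambertW_le x y : 0 <= y -> x <= y * expR y -> lambertW x <= y.
Proof.
move=> y0 xy; case: (leP x 0) => [/lambertW_neg->//|/ltW x0].
have w0 := lambertW_ge0 x; have E := lambertWK x0.
by rewrite leNgt; apply/negP => yw; have := mul_expR_sub_ge y0 (ltW yw); lra.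
Qed.

Lemma lambertW_ge x y : 0 <= y -> y * expR y <= x -> y <= lambertW x.
Proof.
move=> y0 xy.
have x0 : 0 <= x by rewrite (le_trans _ xy)// mulr_ge0 ?expR_ge0.
have w0 := lambertW_ge0 x; have E := lambertWK x0.
by rewrite leNgt; apply/negP => yw; have := mul_expR_sub_ge w0 (ltW yw); lra.
Qed.

Lemma le_lambertW x y : x <= y -> lambertW x <= lambertW y.
Proof.
move=> xy; apply: lambertW_le; first exact: lambertW_ge0.
case: (leP y 0) => [y0|/ltW y0]; last by rewrite lambertWK.
by rewrite lambertW_neg// mul0r; lra.
Qed.

Lemma lambertW_lipschitz x y : x <= y -> lambertW y - lambertW x <= y - x.
Proof.
move=> xy; have w := le_lambertW xy; have := mul_expR_sub_ge (lambertW_ge0 x) w.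
case: (leP y 0) => [y0|/ltW y0]; first by rewrite !lambertW_neg //; lra.
rewrite (lambertWK y0).
case: (leP x 0) => [x0|/ltW x0]; last by rewrite (lambertWK x0).
by rewrite (lambertW_neg x0) mul0r; lra.
Qed.

Lemma continuous_lambertW : continuous (@lambertW R).
Proof.
move=> x; apply/cvgrPdist_lt => e e0; near=> y.
apply: (@le_lt_trans _ _ `|x - y|); last by near: y; exact: cvgr_dist_lt.
case: (leP x y) => [xy|/ltW yx].
  have := lambertW_lipschitz xy; have := le_lambertW xy.
  by move=> ? ?; rewrite distrC [leRHS]distrC !ger0_norm; lra.
have := lambertW_lipschitz yx; have := le_lambertW yx.
by move=> ? ?; rewrite !ger0_norm; lra.
Unshelve. all: by end_near. Qed.

(** Put [y = W(x) + ln c]; then [y e^y = c x + c (ln c) e^(W(x)) >= c x]. *)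
Lemma lambertW_mulr_le (c x : R) : 1 <= c -> 0 <= x ->
  lambertW (c * x) <= lambertW x + ln c.
Proof.
move=> c1 x0; have c0 : 0 < c by lra.
have w0 := lambertW_ge0 x; have l0 : 0 <= ln c by rewrite ln_ge0.
apply: lambertW_le; first exact: addr_ge0.
rewrite expRD lnK ?posrE// -{1}(lambertWK x0) mulrDl.
rewrite -[leLHS]addr0 lerD// ?mulr_ge0 ?expR_ge0//; last lra.
by rewrite le_eqVlt; apply/orP; left; apply/eqP; ring.
Qed.

End LambertW.

(** * The function [phi]: closed form, convexity and growth *)

Section Phi.
Context {R : realType}.
Variable sigma : R.
Hypothesis sigma_gt1 : 1 < sigma.
Implicit Types t : R.
Let b := (sigma - 1)^-1.

Let b_gt0 : 0 < b. Proof. by rewrite invr_gt0 subr_gt0. Qed.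

Lemma phi_le0 t : t <= 0 -> phi sigma t = 0.
Proof. by rewrite /phi leNgt => /negPf ->. Qed.

Lemma phiE t : 0 <= t -> phi sigma t = t * expR ((sigma - 1)^-1 * lambertW t).
Proof.
rewrite le_eqVlt => /orP[/eqP<-|t0]; first by rewrite phi_le0// mul0r.
rewrite /phi t0; have E := lambertWK (ltW t0).
have w0 : 0 < lambertW t.
  rewrite lt_neqAle lambertW_ge0 andbT; apply/eqP => w0; move: E; rewrite -w0 mul0r; lra.
have s0 : sigma - 1 != 0 by rewrite gt_eqF// subr_gt0.
have -> : sigma / (sigma - 1) = 1 + b by rewrite /b; field.
rewrite div1r -/b powRD ?(gt_eqF t0) ?implybT// powRr1 ?(ltW t0)//.
rewrite -mulrA; congr (_ * _).
rewrite -{1}E powRM ?lambertW_ge0 ?expR_ge0// -expRM mulrAC divff ?mul1r 1?mulrC//.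
by rewrite gt_eqF// powR_gt0.
Qed.

Lemma phi_mul_expR (y : R) : 0 <= y ->
  phi sigma (y * expR y) = y * expR y * expR ((sigma - 1)^-1 * y).
Proof. by move=> y0; rewrite phiE ?mulr_ge0 ?expR_ge0// lambertW_mul_expR. Qed.

Lemma phi_ge0 t : 0 <= phi sigma t.
Proof.
case: (leP t 0) => [/phi_le0->//|/ltW t0].
by rewrite phiE// mulr_ge0// expR_ge0.
Qed.

Lemma phi_ge t : t <= phi sigma t.
Proof.
case: (leP t 0) => [t0|/ltW t0]; first by rewrite (le_trans t0)// phi_ge0.
rewrite phiE// ler_peMr// expR_ge1// mulr_ge0 ?lambertW_ge0//; exact: ltW.
Qed.

Lemma le_phi t t' : t <= t' -> phi sigma t <= phi sigma t'.
Proof.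
move=> tt'; case: (leP t 0) => [/phi_le0->|/ltW t0]; first exact: phi_ge0.
rewrite !phiE ?(le_trans t0)//; apply: ler_pM; rewrite ?expR_ge0//.
by rewrite ler_expR ler_pM2l// le_lambertW.
Qed.

Lemma continuous_phi : continuous (phi sigma).
Proof.
have -> : phi sigma = (fun t => Num.max 0 t) \* (expR \o (fun t => b * lambertW t)).
  apply/funext => t /=; case: (leP 0 t) => [t0|/ltW t0]; first exact: phiE.
  by rewrite mul0r phi_le0.
move=> t; apply: continuousM.
  by apply: continuous_max; [exact: cvg_cst|exact: cvg_id].
apply: continuous_comp; last exact: continuous_expR.
by apply: continuousM; [exact: cvg_cst|exact: continuous_lambertW].
Qed.

(* The slope is the derivative [e^(b w) (1 + b w / (1 + w))] at [t0 = w e^w],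
   where [b = 1 / (sigma - 1)]. *)
Lemma phi_supporting_line t0 :
  exists m, forall t, phi sigma t0 + m * (t - t0) <= phi sigma t.
Proof.
case: (leP t0 0) => [t0le|/ltW t0ge].
  by exists 0 => t; rewrite mul0r addr0 phi_le0// phi_ge0.
set w := lambertW t0.
have w0 : 0 <= w by exact: lambertW_ge0.
have t0E : t0 = w * expR w by rewrite lambertWK.
pose c := b * w / (1 + w).
have c0 : 0 <= c by rewrite divr_ge0 ?mulr_ge0// ?ltW//; lra.
have cE : c * (1 + w) = b * w by rewrite divfK// gt_eqF//; lra.
exists (expR (b * w) * (1 + c)) => t; rewrite (phiE t0ge) -/w -/b.
case: (leP 0 t) => [tge|/ltW tle]; last first.
  rewrite (phi_le0 tle).
  have -> : t0 * expR (b * w) + expR (b * w) * (1 + c) * (t - t0) =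
    expR (b * w) * ((1 + c) * t - c * t0) by ring.
  rewrite mulr_ge0_le0 ?expR_ge0// subr_le0 (@le_trans _ _ 0)//.
    by rewrite mulr_ge0_le0//; lra.
  exact: mulr_ge0.
set y := lambertW t.
have y0 : 0 <= y by exact: lambertW_ge0.
have tE : t = y * expR y by rewrite lambertWK.
rewrite (phiE tge) -/y -/b.
have -> : expR (b * y) = expR (b * w) * expR (b * (y - w)).
  by rewrite -expRD; congr expR; ring.
rewrite [leRHS]mulrCA [X in X + _]mulrC -mulrA -mulrDr ler_pM2l ?expR_gt0//.
have -> : t0 + (1 + c) * (t - t0) = t + c * (t - t0) by ring.
set u := y - w.
(* After division by [e^(b w)], the exponential [e^(b u)] is replaced by its tangent [1 + b u]; it
   remains to show [c (t - t0) <= t b u]. *)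
have eu := expR_ge1Dx (b * u).
apply: (@le_trans _ _ (t * (1 + b * u))); last exact: ler_wpM2l.
rewrite [leRHS]mulrDr mulr1 lerD2l.
have e1 : expR y = expR w * expR u by rewrite -expRD; congr expR; rewrite /u; ring.
have e2 : expR w = expR y * expR (- u) by rewrite -expRD; congr expR; rewrite /u; ring.
rewrite t0E tE e2.
have -> : c * (y * expR y - w * (expR y * expR (- u))) =
  expR y * (c * (y - w * expR (- u))) by ring.
have -> : y * expR y * (b * u) = expR y * (y * (b * u)) by ring.
rewrite ler_pM2l ?expR_gt0//.
have eu' := expR_ge1Dx (- u).
apply: (@le_trans _ _ (c * (u * (1 + w)))).
  apply: ler_wpM2l => //.
  have -> : u * (1 + w) = y - w * (1 + - u) by rewrite /u; ring.
  by rewrite lerD2l lerN2 ler_wpM2l.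
have -> : c * (u * (1 + w)) = w * (b * u) by rewrite mulrCA cE; ring.
(* What is left is [(y - w) b u = b u^2 >= 0]. *)
rewrite -subr_ge0 -mulrBl -/u mulrCA; apply: mulr_ge0; first exact: ltW.
by rewrite -expr2 sqr_ge0.
Qed.

(** In the combination, with weights [p] and [1 - p], of the supporting-line inequalities at the
    mean point, the slope cancels. *)
Lemma convex_phi : convex_function [set: R] (phi sigma).
Proof.
move=> t x y _ _.
change (phi sigma (t%:num * x + (1 - t%:num) * y) <=
  t%:num * phi sigma x + (1 - t%:num) * phi sigma y).
have : 0 <= t%:num <= 1 by apply/andP.
move: t%:num => p /andP[p0 p1].
have [m mP] := phi_supporting_line (p * x + (1 - p) * y).
have /(ler_wpM2l p0) hx := mP x.
have p1' : 0 <= 1 - p by lra.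
have /(ler_wpM2l p1') hy := mP y.
by move: (phi sigma (p * x + (1 - p) * y)) hx hy => z; nra.
Qed.

(** Doubling [t] adds at most [ln 2] to [W(t)]. With [c = ln 2] and [t = ln x] this is condition
    (alpha). *)
Lemma phi_addr_le (c t : R) : 0 <= c -> c <= t ->
  phi sigma (t + c) <= 2 * expR ((sigma - 1)^-1 * ln 2) * phi sigma t.
Proof.
move=> c0 ct; have t0 : 0 <= t by lra.
apply: (@le_trans _ _ (phi sigma (2 * t))); first by apply: le_phi; lra.
rewrite !phiE ?mulr_ge0// -/b.
have -> : 2 * expR (b * ln 2) * (t * expR (b * lambertW t)) =
  2 * t * expR (b * (lambertW t + ln 2)) by rewrite mulrDr expRD; ring.
rewrite ler_wpM2l ?mulr_ge0// ler_expR ler_pM2l//; apply: lambertW_mulr_le => //; lra.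
Qed.

(** This is condition (beta) in the variable [t = ln x]. Half of the exponent [t] absorbs the factor
    [t], the other half absorbs [b W(t)]. *)
Lemma phi_le_expR t : 0 <= t ->
  phi sigma t <= 2 * expR (2 * (sigma - 1)^-1 ^+ 2) * expR t.
Proof.
move=> t0; rewrite phiE// -/b.
set w := lambertW t; have w0 : 0 <= w by exact: lambertW_ge0.
have tE : t = w * expR w by rewrite lambertWK.
have h : b * w <= t / 2 + 2 * b ^+ 2.
  have b2 : 0 <= 2 * b ^+ 2 by rewrite mulr_ge0 // sqr_ge0.
  (* If [e^w >= 2 b], then [b w <= w e^w / 2 = t / 2]; otherwise [w <= 2 b], and [b w <= 2 b^2]. *)
  case: (leP (2 * b) (expR w)) => h.
    suff : b * w <= t / 2 by lra.
    rewrite tE mulrC -mulrA ler_wpM2l//; lra.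
  have := expR_ge1Dx w => h'; have hw : w <= 2 * b by lra.
  apply: (@le_trans _ _ (2 * b ^+ 2)); last lra.
  by rewrite expr2 mulrCA ler_wpM2l// ltW.
have t2 : t <= 2 * expR (t / 2) by have := expR_ge1Dx (t / 2); lra.
have -> : 2 * expR (2 * b ^+ 2) * expR t = 2 * expR (t / 2) * expR (t / 2 + 2 * b ^+ 2).
  have -> : expR t = expR (t / 2) * expR (t / 2) by rewrite -expRD; congr expR; field.
  by rewrite expRD; ring.
by apply: ler_pM; rewrite ?expR_ge0// ler_expR.
Qed.

(** The factor [e^(b W(t))] exceeds [A] as soon as [b W(t) >= A]. This yields condition (gamma) and
    the finiteness of the Young conjugate. *)
Lemma phi_superlinear (A : R) : exists t0 : R, 0 <= t0 /\
  forall t, t0 <= t -> A * t <= phi sigma t.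
Proof.
pose y := Num.max 0 (A / b); have y0 : 0 <= y by rewrite le_max lexx.
exists (y * expR y); split=> [|t ht]; first by rewrite mulr_ge0 ?expR_ge0.
have t0 : 0 <= t by rewrite (le_trans _ ht)// mulr_ge0 ?expR_ge0.
rewrite phiE// mulrC ler_wpM2l// -/b.
have := lambertW_ge y0 ht => hw.
apply: (@le_trans _ _ (b * lambertW t)); last by have := expR_ge1Dx (b * lambertW t); lra.
rewrite mulrC -ler_pdivrMr//; apply: le_trans hw; by rewrite le_max lexx orbT.
Qed.

End Phi.

(** * The function [phi (ln_plus |k|)] is a weight function *)

Section WeightFunction.
Context {R : realType}.
Variable sigma : R.
Hypothesis sigma_gt1 : 1 < sigma.
Implicit Types k : R.

Lemma ln_plus_ge0 k : 0 <= ln_plus k.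
Proof. by rewrite /ln_plus; case: ifP; rewrite // le_max lexx. Qed.

Lemma ln_plusE k : 0 <= k -> ln_plus k = ln (Num.max 1 k).
Proof.
move=> k0; rewrite /ln_plus; case: (ltP 0 k) => [{}k0|k0']; last first.
  by rewrite max_l ?ln1//; lra.
case: (leP 1 k) => k1.
- by rewrite max_r // ln_ge0.
- by rewrite max_l ?ln1 // ln_le0 // ltW.
Qed.

Lemma ln_plus_expR t : ln_plus (expR t : R) = Num.max 0 t.
Proof. by rewrite /ln_plus expR_gt0 expRK. Qed.

Lemma ln_plus_ge1 k : 1 <= k -> ln_plus k = ln k.
Proof. by move=> k1; rewrite ln_plusE ?max_r//; lra. Qed.

Lemma le_ln_plus k k' : 0 <= k -> k <= k' -> ln_plus k <= ln_plus k'.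
Proof.
move=> k0 kk'; rewrite !ln_plusE ?(le_trans k0)// ler_ln ?posrE ?lt_max ?ltr01//.
by rewrite ge_max !le_max lexx kk' orbT.
Qed.

Lemma continuous_ln_plus_norm : continuous (fun k => ln_plus `|k|).
Proof.
have -> : (fun k => ln_plus `|k|) = @ln R \o (fun k => Num.max 1 `|k|).
  by apply/funext => k /=; rewrite ln_plusE.
move=> k; apply: continuous_comp; last first.
  by apply: continuous_ln; rewrite lt_max ltr01.
by apply: continuous_max; [exact: cvg_cst|exact: norm_continuous].
Qed.

Local Notation infty := (pinfty_nbhs R).

Lemma bigO_inftyP (f g : R -> R) :
  (exists C A : R, forall x, A <= x -> `|f x| <= C * `|g x|) ->
  f =O_infty g.
Proof.
move=> [C [A h]]; apply/eqO_exP; exists (Num.max 1 C).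
  by rewrite lt_max ltr01.
near=> x; have Ax : A <= x by near: x; apply: nbhs_pinfty_ge; exact: num_real.
apply: le_trans (h _ Ax) _; rewrite ler_wpM2r// le_max lexx orbT//.
Unshelve. all: by end_near. Qed.

Lemma phi_ln_plus_expR t : phi sigma (ln_plus (expR t)) = phi sigma t.
Proof.
rewrite ln_plus_expR; case: (leP t 0) => [t0|/ltW t0].
- by rewrite !phi_le0.
- by [].
Qed.

Lemma weight_function_phi : weight_function (fun k => phi sigma (ln_plus `|k|)).
Proof.
split; split.
- by move=> t; exact: phi_ge0.
- move=> t; apply: (@continuous_comp _ _ _ (fun k : R => ln_plus `|k|) (phi sigma)).
    exact: continuous_ln_plus_norm.
  exact: continuous_phi.
- by move=> t; rewrite normrN.
- move=> s t s0 st; apply: le_phi => //; apply: le_ln_plus => //.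
  by rewrite !ger0_norm// (le_trans s0).
- by rewrite normr0 ln_plusE// max_l// ln1 phi_le0.
- apply: bigO_inftyP; exists (2 * expR ((sigma - 1)^-1 * ln 2)), 2 => x x2.
  have x0 : 0 < x by lra.
  rewrite [X in X <= _]ger0_norm ?phi_ge0// [`|phi _ _|]ger0_norm ?phi_ge0//.
  rewrite (gtr0_norm x0) gtr0_norm ?mulr_gt0// !ln_plus_ge1; try lra.
  rewrite lnM ?posrE// addrC; apply: phi_addr_le => //.
  - by rewrite ln_ge0//; lra.
  - by rewrite ler_ln ?posrE.
- apply: bigO_inftyP; exists (2 * expR (2 * (sigma - 1)^-1 ^+ 2)), 1 => x x1.
  have x0 : 0 < x by lra.
  rewrite [X in X <= _]ger0_norm ?phi_ge0// (gtr0_norm x0) ln_plus_ge1//.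
  by rewrite -{2}(lnK x0); apply: phi_le_expR => //; rewrite ln_ge0.
- apply/eqoP => e e0.
  have [t0 [t00 ht]] := phi_superlinear sigma_gt1 e^-1.
  near=> x.
  have x1 : Num.max 1 (expR t0) <= x by near: x; apply: nbhs_pinfty_ge; exact: num_real.
  move: x1; rewrite ge_max => /andP[x1 xt].
  have x0 : 0 < x by lra.
  have lt0 : t0 <= ln x by rewrite -(expRK t0) ler_ln ?posrE// expR_gt0.
  rewrite !ger0_norm ?phi_ge0 ?ln_ge0// ?(ltW x0)// ln_plus_ge1//.
  by rewrite -ler_pdivrMl//; exact: ht.
(* As [phi] vanishes on the negative half-line, truncating [t] at 0 changes nothing, and (delta) is
   the convexity of [phi] on the whole line. *)
- have -> : (fun t => phi sigma (ln_plus `|expR t|)) = phi sigma.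
    by apply/funext => t; rewrite ger0_norm ?expR_ge0// phi_ln_plus_expR.
  exact: convex_phi.
Unshelve. all: by end_near. Qed.

Lemma equiv_fun_refl (f : R -> R) : equiv_fun f f.
Proof. by split; apply: bigO_inftyP; exists 1, 0 => x _; rewrite mul1r. Qed.

End WeightFunction.

(** * Upper and lower bounds for the terms of [Tfun] *)

Section AssociatedFunction.
Context {R : realType}.
Variable sigma : R.
Hypothesis sigma_gt1 : 1 < sigma.
Implicit Types (tau h k L : R) (p : nat).
Let a := sigma - 1.
Let b := (sigma - 1)^-1.

Let a_gt0 : 0 < a. Proof. by rewrite subr_gt0. Qed.
Let b_gt0 : 0 < b. Proof. by rewrite invr_gt0. Qed.
Let ab1 : a * b = 1. Proof. by rewrite mulfV// gt_eqF. Qed.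

Lemma Mseq_gt0 tau p : 0 < Mseq tau sigma p.
Proof. by rewrite /Mseq; case: p => [|p]//=; rewrite powR_gt0. Qed.

Lemma natr_powR_sigma p : (0 < p)%N ->
  p%:R `^ sigma = p%:R * p%:R `^ (sigma - 1) :> R.
Proof.
move=> p0; have -> : p%:R `^ sigma = p%:R `^ (1 + (sigma - 1)) :> R.
  by congr (_ `^ _); ring.
by rewrite (@powRD _ _ 1) ?powRr1// pnatr_eq0 -lt0n p0 implybT.
Qed.

Lemma ln_Mseq tau p : (0 < p)%N ->
  ln (Mseq tau sigma p) = tau * (p%:R * p%:R `^ (sigma - 1)) * ln p%:R.
Proof. by move=> p0; rewrite /Mseq gtn_eqF// ln_powR natr_powR_sigma. Qed.

Lemma ln_Tfun_term tau h k p : 0 < h -> 0 < k -> (0 < p)%N ->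
  ln (h `^ (p%:R `^ sigma) * k ^+ p / Mseq tau sigma p) =
  p%:R * (ln k - p%:R `^ (sigma - 1) * (tau * ln p%:R - ln h)).
Proof.
move=> h0 k0 p0; have M0 := Mseq_gt0 tau p.
rewrite ln_div ?posrE ?mulr_gt0 ?powR_gt0 ?exprn_gt0//.
rewrite lnM ?posrE ?powR_gt0 ?exprn_gt0// ln_powR lnXn// ln_Mseq//.
by rewrite natr_powR_sigma// -mulr_natl; ring.
Qed.

Lemma ge0_ler_powR_a (x y : R) : 0 <= x -> x <= y ->
  x `^ (sigma - 1) <= y `^ (sigma - 1).
Proof.
move=> x0 xy; apply: ge0_ler_powR => //; first exact: (ltW a_gt0).
by rewrite nnegrE (le_trans x0).
Qed.

Lemma expR_le_of_lambertW L : 0 <= L -> 1 <= lambertW L -> expR (lambertW L) <= L.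
Proof. by move=> L0 w1; rewrite -[leRHS]lambertWK// ler_peMl// expR_ge0. Qed.

(* Indices [p >= A e^(b W(L))] give a nonpositive logarithm; the others satisfy
   [p^(sigma-1) <= A^(sigma-1) e^(W(L))]. *)
Lemma Tfun_term_le tau h : 0 < h -> 0 < tau -> exists2 C : R, 0 <= C &
  forall k, 1 <= k -> 1 <= lambertW (ln k) -> forall p,
  ln_plus (h `^ (p%:R `^ sigma) * k ^+ p / Mseq tau sigma p) <= C * phi sigma (ln k).
Proof.
move=> h0 tau0.
(* The two summands ensure [A^a >= 1 / (tau b)] and [tau ell >= ln h]; both are used for large
   [p]. *)
pose ell := b * `|ln (tau * b)| + `|ln h| / tau.
have ell0 : 0 <= ell by rewrite addr_ge0// ?divr_ge0 ?mulr_ge0// ltW.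
pose A := expR ell.
pose C := A * (1 + A `^ a * `|ln h|).
have C0 : 0 <= C by rewrite mulr_ge0 ?expR_ge0// addr_ge0// mulr_ge0// powR_ge0.
exists C => // k k1 w1 p; set L := ln k.
have k0 : 0 < k by lra.
have L0 : 0 <= L by rewrite ln_ge0.
have Cphi0 : 0 <= C * phi sigma L by rewrite mulr_ge0// phi_ge0.
(* For [p = 0] the term is 1, because [0^sigma = 0] when [sigma] is nonzero. *)
case: (posnP p) => [->|p0].
  have s0 : sigma != 0 by rewrite gt_eqF// (lt_trans ltr01).
  rewrite /Mseq eqxx expr0 mulr1 divr1 powR0// powRr0.
  by rewrite ln_plus_ge1// ln1.
rewrite /ln_plus; case: ifP => // _; rewrite ge_max Cphi0/= ln_Tfun_term// -/L -/a.
set w := lambertW L in w1 *.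
have w0 : 0 <= w by lra.
have LE : L = w * expR w by rewrite lambertWK.
have p1 : (1 : R) <= p%:R by rewrite ler1n.
have pR0 : (0 : R) < p%:R by lra.
have lp0 : 0 <= ln (p%:R : R) by rewrite ln_ge0.
have powA : (A * expR (b * w)) `^ a = A `^ a * expR w.
  rewrite powRM ?expR_ge0// -expRM; congr (_ * expR _).
  by rewrite mulrAC (mulrC b) ab1 mul1r.
case: (leP p%:R (A * expR (b * w))) => hp.
(* For small [p] the nonnegative [tau ln p] is dropped, and [p^a <= A^a e^w <= A^a L] because
   [w >= 1]. *)
- rewrite phiE// -/b -/w.
  have pa : p%:R `^ a <= A `^ a * L.
    apply: (@le_trans _ _ ((A * expR (b * w)) `^ a)); first exact: ge0_ler_powR_a.
    by rewrite powA ler_wpM2l ?powR_ge0// expR_le_of_lambertW.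
  have h1 : - (p%:R `^ a * (tau * ln p%:R - ln h)) <= A `^ a * L * `|ln h|.
    apply: (@le_trans _ _ (p%:R `^ a * `|ln h|)); last by rewrite ler_wpM2r.
    rewrite -mulrN ler_wpM2l ?powR_ge0//.
    have := ler_norm (ln h); have : 0 <= tau * ln (p%:R : R) by rewrite mulr_ge0// ltW.
    lra.
  apply: (@le_trans _ _ (p%:R * ((1 + A `^ a * `|ln h|) * L))).
    by rewrite ler_pM2l//; lra.
  have -> : C * (L * expR (b * w)) = A * expR (b * w) * ((1 + A `^ a * `|ln h|) * L).
    by rewrite /C; ring.
  by rewrite ler_wpM2r// mulr_ge0// addr_ge0// mulr_ge0// powR_ge0.
(* For large [p], [p^a >= A^a e^w >= e^w / (tau b)] and [tau ln p - ln h >= tau b w], so the product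
   is at least [w e^w = L]. *)
- apply: le_trans Cphi0; rewrite mulr_ge0_le0 ?ler0n// subr_le0.
  have lp : ell + b * w <= ln p%:R.
    by rewrite -ler_expR lnK ?posrE// expRD ltW.
  have h1 : tau * b * w <= tau * ln p%:R - ln h.
    have := ler_wpM2l (ltW tau0) lp.
    have : ln h <= tau * ell.
      rewrite /ell mulrDr [tau * (_ / tau)]mulrC divfK ?gt_eqF//.
      have : 0 <= tau * (b * `|ln (tau * b)|) by rewrite !mulr_ge0// ltW.
      by have := ler_norm (ln h); lra.
    move=> h1 h2; rewrite mulrDr in h2; rewrite -mulrA.
    by move: (tau * ell) (tau * (b * w)) h1 h2 => u v; lra.
  have tbw0 : 0 <= tau * b * w by rewrite !mulr_ge0// ltW.
  have Aa : (tau * b)^-1 <= A `^ a.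
    have tb0 : 0 < tau * b by rewrite mulr_gt0.
    rewrite /A -expRM -(@lnK _ (tau * b)^-1) ?posrE ?invr_gt0// ler_expR lnV ?posrE//.
    apply: (@le_trans _ _ (b * `|ln (tau * b)| * a)).
      rewrite mulrAC (mulrC b) ab1 mul1r; have := ler_norm (- ln (tau * b)).
      by rewrite normrN.
    by rewrite ler_wpM2r ?(ltW a_gt0)// lerDl divr_ge0// ltW.
  apply: (@le_trans _ _ (A `^ a * expR w * (tau * b * w))).
    rewrite LE.
    have -> : w * expR w = (tau * b)^-1 * (expR w * (tau * b * w)).
      by field; rewrite !gt_eqF.
    by rewrite -[leRHS]mulrA ler_wpM2r// mulr_ge0// expR_ge0.
  apply: ler_pM => //; first by rewrite mulr_ge0 ?powR_ge0 ?expR_ge0.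
  by rewrite -powA ge0_ler_powR_a ?mulr_ge0 ?expR_ge0// ltW.
Qed.

(* Take [p] to be the integral part of [eps e^(b W(L))] with [eps] small. *)
Lemma Tfun_term_ge tau h : 0 < h -> 0 < tau -> exists c y : R,
  [/\ 0 < c, 0 <= y & forall k, 1 <= k -> y <= lambertW (ln k) -> exists p,
  c * phi sigma (ln k) <= ln_plus (h `^ (p%:R `^ sigma) * k ^+ p / Mseq tau sigma p)].
Proof.
(* If [ln p <= b w] and [w >= 1], then [tau ln p - ln h <= D w]. The choice of [eps] gives
   [eps^a = e^(-2D)], and [D e^(-2D) <= 1/2] leaves half of [L]. The bound [w >= 1 + 2 D] makes
   [x >= 1], hence [p >= 1]. *)
move=> h0 tau0; pose D := tau * b + `|ln h|.
have D0 : 0 < D by rewrite ltr_pwDl// mulr_gt0.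
pose eps := expR (- (2 * b * D)).
have eps0 : 0 < eps by exact: expR_gt0.
exists (eps / 4), (1 + 2 * D); split; [by rewrite divr_gt0| by lra|].
move=> k k1 wy; set L := ln k in wy *; set w := lambertW L in wy *.
have k0 : 0 < k by lra.
have L0 : 0 <= L by rewrite ln_ge0.
have w0 : 0 <= w by lra.
have LE : L = w * expR w by rewrite lambertWK.
set x := eps * expR (b * w).
have x1 : 1 <= x.
  by rewrite /x -expRD expR_ge1// addrC -mulrA [2 * _]mulrCA -mulrBr mulr_ge0 ?(ltW b_gt0)//; lra.
have x0 : 0 <= x by lra.
exists (Num.trunc x); set p := Num.trunc x.
have /andP[px xp] : p%:R <= x < p.+1%:R by exact: truncn_itv.
have p0 : (0 < p)%N by rewrite truncn_gt0.
have p1 : (1 : R) <= p%:R by rewrite ler1n.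
have pR0 : (0 : R) < p%:R by lra.
(* Here [x < p + 1 <= 2 p]. *)
have p2 : x / 2 <= p%:R by move: xp; rewrite -natr1; lra.
rewrite /ln_plus mulr_gt0 ?invr_gt0 ?Mseq_gt0 ?mulr_gt0 ?powR_gt0 ?exprn_gt0//.
rewrite le_max ln_Tfun_term// -/L; apply/orP; right.
have lp : ln (p%:R : R) <= b * w.
  rewrite -[leRHS]expRK ler_ln ?posrE ?expR_gt0// (le_trans px)//.
  rewrite ler_piMl ?expR_ge0// expR_le1 oppr_le0 !mulr_ge0// ltW//.
have pa : p%:R `^ (sigma - 1) <= expR (- (2 * D)) * expR w.
  apply: (@le_trans _ _ (x `^ (sigma - 1))); first exact: ge0_ler_powR_a.
  rewrite /x /eps -!expRD -expRM ler_expR -/a.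
  have -> : (- (2 * b * D) + b * w) * a = (a * b) * (- (2 * D) + w) by ring.
  by rewrite ab1 mul1r.
have h1 : p%:R `^ (sigma - 1) * (tau * ln p%:R - ln h) <= L / 2.
  apply: (@le_trans _ _ (expR (- (2 * D)) * expR w * (D * w))).
    apply: (@le_trans _ _ (p%:R `^ (sigma - 1) * (D * w))).
      rewrite ler_wpM2l ?powR_ge0// mulrDl.
      have := ler_wpM2l (ltW tau0) lp; have := ler_norm (- ln h); rewrite normrN.
      have : `|ln h| <= `|ln h| * w by rewrite ler_peMr//; lra.
      by rewrite -mulrA; lra.
    by rewrite ler_wpM2r// mulr_ge0// ltW.
  have -> : expR (- (2 * D)) * expR w * (D * w) = L * (expR (- (2 * D)) * D).
    by rewrite LE; ring.
  rewrite ler_wpM2l// expRN ler_pdivrMl ?expR_gt0//.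
  by have := expR_ge1Dx (2 * D); lra.
apply: (@le_trans _ _ (p%:R * (L / 2))); last by rewrite ler_pM2l//; lra.
rewrite phiE// -/w -/b.
have -> : eps / 4 * (L * expR (b * w)) = x / 2 * (L / 2) by rewrite /x; field.
by rewrite ler_wpM2r// divr_ge0.
Qed.

End AssociatedFunction.

(** * Equivalence of [Tfun] with the weight; comparison of [Mseq] and [Nseq] *)

Section WeightMatrixComparison.
Context {R : realType}.
Variable sigma : R.
Hypothesis sigma_gt1 : 1 < sigma.
Implicit Types (tau h k t H : R) (p : nat).
Let a := sigma - 1.
Let b := (sigma - 1)^-1.

Let a_gt0 : 0 < a. Proof. by rewrite subr_gt0. Qed.
Let b_gt0 : 0 < b. Proof. by rewrite invr_gt0. Qed.
Let ab1 : a * b = 1. Proof. by rewrite mulfV// gt_eqF. Qed.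

Local Notation infty := (pinfty_nbhs R).

Lemma equiv_fun_Tfun tau h : 0 < h -> 0 < tau ->
  equiv_fun (fun k => Tfun tau sigma h `|k|) (fun k => phi sigma (ln_plus `|k|)).
Proof.
move=> h0 tau0.
have [C C0 hC] := Tfun_term_le sigma_gt1 h0 tau0.
have [c [y [c0 y0 hc]]] := Tfun_term_ge sigma_gt1 h0 tau0.
pose z := Num.max 1 y.
have z0 : 0 <= z by rewrite le_max ler01.
pose k0 := expR (z * expR z).
have k01 : 1 <= k0 by rewrite expR_ge1// mulr_ge0 ?expR_ge0.
have zW k : k0 <= k -> z <= lambertW (ln k).
  move=> kk; apply: lambertW_ge => //.
  by rewrite -[leLHS]expRK ler_ln ?posrE ?expR_gt0//; lra.
have W1 k : k0 <= k -> 1 <= lambertW (ln k).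
  by move=> /zW; apply: le_trans; rewrite le_max lexx.
have Wy k : k0 <= k -> y <= lambertW (ln k).
  by move=> /zW; apply: le_trans; rewrite le_max lexx orbT.
have T0 k : k0 <= k -> 0 <= Tfun tau sigma h k <= C * phi sigma (ln k).
  move=> kk; have k1 : 1 <= k by lra.
  (* The bound makes the real [sup] a genuine supremum, so that single terms lie below it. *)
  have ub : ubound [set ln_plus (h `^ (p%:R `^ sigma) * k ^+ p / Mseq tau sigma p)
      | p in [set: nat]] (C * phi sigma (ln k)).
    by move=> _ [p _ <-]; apply: hC => //; exact: W1.
  apply/andP; split.
    apply: le_trans (ln_plus_ge0 (h `^ (0%N%:R `^ sigma) * k ^+ 0 / Mseq tau sigma 0)) _.
    apply: ub_le_sup; first by exists (C * phi sigma (ln k)).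
    by exists 0%N.
  apply: ge_sup => //.
  by exists (ln_plus (h `^ (0%N%:R `^ sigma) * k ^+ 0 / Mseq tau sigma 0)); exists 0%N.
split; apply: bigO_inftyP.
- exists C, k0 => k kk; have kp : 0 < k by lra.
  have /andP[Tge Tle] := T0 _ kk.
  by rewrite (gtr0_norm kp) ger0_norm// ger0_norm ?phi_ge0// ln_plus_ge1//; lra.
- exists c^-1, k0 => k kk; have kp : 0 < k by lra.
  have /andP[Tge Tle] := T0 _ kk; have k1 : 1 <= k by lra.
  rewrite (gtr0_norm kp) ger0_norm ?phi_ge0// ger0_norm// ln_plus_ge1//.
  rewrite ler_pdivlMl//; have [p hp] := hc _ k1 (Wy _ kk); apply: le_trans hp _.
  apply: ub_le_sup; last by exists p.
  exists (C * phi sigma (ln k)) => _ [q _ <-]; apply: hC => //; exact: W1.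
Qed.

(** Beyond the threshold of superlinear growth the expression is at most 0; before it, at most
    [k t0]. *)
Let ubound_young k : 0 <= k ->
  has_ubound [set k * t - phi sigma t | t in [set t | 0 < t]].
Proof.
move=> k0; have [t0 [t00 ht0]] := phi_superlinear sigma_gt1 k.
exists (k * t0) => _ [t /= tgt0 <-]; have p0 := phi_ge0 sigma_gt1 t.
have kt0 : 0 <= k * t0 by exact: mulr_ge0.
case: (leP t0 t) => [/ht0|/ltW/(ler_wpM2l k0)]; lra.
Qed.

Lemma young_conj_ge k t : 0 <= k -> 0 < t ->
  k * t - phi sigma t <= young_conj (phi sigma) k.
Proof. by move=> k0 t0; apply: ub_le_sup; [exact: ubound_young|exists t]. Qed.

Lemma young_conj_le k (B : R) : (forall t, 0 < t -> k * t - phi sigma t <= B) ->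
  young_conj (phi sigma) k <= B.
Proof.
move=> kB; apply: ge_sup; first by exists (k * 1 - phi sigma 1); exists 1 => //=.
by move=> _ [t /= t0 <-]; exact: kB.
Qed.

(** The supremum of [- phi t] over [t > 0] is not attained, but [phi t <= t phi 1] for [t <= 1]
    brings it arbitrarily close to 0. The value fixes [Nseq] at index 0, where [C^p] gives no
    room. *)
Lemma young_conj0 : young_conj (phi sigma) 0 = 0.
Proof.
apply/eqP; rewrite eq_le; apply/andP; split.
  by apply: young_conj_le => t _; rewrite mul0r sub0r oppr_le0 phi_ge0.
rewrite leNgt; apply/negP; set y := young_conj _ _ => y0.
have phi1 := phi_ge sigma_gt1 1.
have phi10 : 0 < phi sigma 1 by lra.
pose t := Num.min 1 (- y / (2 * phi sigma 1)).
have t0 : 0 < t by rewrite lt_min ltr01 divr_gt0 ?mulr_gt0// oppr_gt0.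
have t1 : t <= 1 by rewrite ge_min lexx.
have ty : t * phi sigma 1 <= - y / 2.
  have : t <= - y / (2 * phi sigma 1) by rewrite ge_min lexx orbT.
  rewrite ler_pdivlMr ?mulr_gt0//; lra.
have : phi sigma t <= t * phi sigma 1.
  rewrite !phiE ?(ltW t0)// mul1r ler_pM2l// ler_expR ler_pM2l//; exact: le_lambertW.
by have := young_conj_ge (lexx 0) t0; rewrite -/y; lra.
Qed.

Lemma Nseq0 H : Nseq H sigma 0 = 1.
Proof. by rewrite /Nseq mulr0 young_conj0 mulr0 expR0. Qed.

Lemma Nseq_gt0 H p : 0 < Nseq H sigma p. Proof. exact: expR_gt0. Qed.

(** For each [t], the quantity [p t - phi t / H] increases with [H]. *)
Lemma le_Nseq H H' p : 0 < H -> H <= H' -> Nseq H sigma p <= Nseq H' sigma p.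
Proof.
move=> H0 HH; have H'0 : 0 < H' by lra.
rewrite ler_expR ler_pdivrMl//; apply: young_conj_le => t t0.
have : 0 <= H' * p%:R by rewrite mulr_ge0// ltW.
move=> /young_conj_ge /(_ t0).
move: (young_conj _ _) => Y hY.
rewrite -(ler_pM2l H'0) [H * (_ * _)]mulrCA mulVKf ?gt_eqF//.
have := ler_wpM2r (phi_ge0 sigma_gt1 t) HH; have := ler_wpM2l (ltW H0) hY; lra.
Qed.

Lemma le_Mseq tau tau' p : tau <= tau' -> Mseq tau sigma p <= Mseq tau' sigma p.
Proof.
case: p => [|p] tt; rewrite /Mseq//= ler_powR ?ler1n//.
by rewrite ler_wpM2r// powR_ge0.
Qed.

Lemma weight_sequence_Mseq tau : 0 < tau -> weight_sequence (Mseq tau sigma).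
Proof.
move=> tau0; split=> [p|]; first exact: Mseq_gt0.
apply/cvgryPge => A; near=> p.
have hp : expR (A / tau) <= p%:R by near: p; exact: nbhs_infty_ger.
have p0 : (0 < p)%N by rewrite -(ltr0n R) (lt_le_trans _ hp)// expR_gt0.
have pR0 : (0 : R) < p%:R by rewrite ltr0n.
have lp : A <= tau * ln p%:R.
  by rewrite -ler_pdivrMl// mulrC -[leLHS]expRK ler_ln ?posrE ?expR_gt0.
rewrite /Mseq gtn_eqF// -powRrM (@natr_powR_sigma _ sigma)//.
have -> : tau * (p%:R * p%:R `^ (sigma - 1)) / p%:R = tau * p%:R `^ (sigma - 1).
  by field; rewrite gt_eqF.
have lp0 : (0 : R) <= ln p%:R by rewrite ln_ge0// ler1n.
have P1 : 1 <= p%:R `^ (sigma - 1) :> R.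
  by rewrite -[leLHS](powRr0 p%:R) ler_powR ?ler1n// ltW.
rewrite [leRHS]/powR gt_eqF//.
set X := _ * ln _; have := expR_ge1Dx X.
suff : tau * ln p%:R <= X by lra.
by rewrite /X mulrAC ler_peMr// mulr_ge0// ltW.
Unshelve. all: by end_near. Qed.

(** Testing the conjugate at one fixed [t >= A] bounds the [p]-th root below by
    [e^(t - phi t / (H p))], which is at least [e^(t - 1) >= A] for large [p]. *)
Lemma weight_sequence_Nseq H : 0 < H -> weight_sequence (Nseq H sigma).
Proof.
move=> H0; split=> [p|]; first exact: Nseq_gt0.
apply/cvgryPge => A; near=> p.
pose t := Num.max 1 A; have t1 : 1 <= t by rewrite le_max lexx.
have hp : Num.max 1 (phi sigma t / H) <= p%:R by near: p; exact: nbhs_infty_ger.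
move: hp; rewrite ge_max => /andP[p1 hp].
have pR0 : (0 : R) < p%:R by lra.
have t0 : 0 < t by lra.
rewrite /Nseq -expRM; apply: (@le_trans _ _ (expR (t - 1))).
  apply: (@le_trans _ _ t); first by rewrite le_max lexx orbT.
  by have := expR_ge1Dx (t - 1); lra.
rewrite ler_expR ler_pdivlMr// ler_pdivlMl//.
have Hp0 : 0 <= H * p%:R by rewrite mulr_ge0// ltW.
apply: le_trans (young_conj_ge Hp0 t0).
by move: hp; rewrite ler_pdivrMr//; lra.
Unshelve. all: by end_near. Qed.

(** The finitely many remaining ratios are absorbed by adding them all to the constant. *)
Lemma le_mulr_of_eventually (M N : nat -> R) (p0 : R) :
  (forall p, 0 < M p) -> (forall p, 0 < N p) ->
  (forall p, p0 <= p%:R -> M p <= N p) ->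
  exists2 C : R, 1 <= C & forall p, M p <= C * N p.
Proof.
move=> M0 N0 h; pose n := (Num.trunc p0).+1.
have S0 q : 0 <= \sum_(i < q) M i / N i.
  by apply: sumr_ge0 => i _; rewrite divr_ge0 ?ltW.
exists (1 + \sum_(i < n) M i / N i); first by rewrite lerDl.
move=> p; rewrite -ler_pdivrMr//; case: (ltnP p n) => pn.
  rewrite (bigD1 (Ordinal pn))//= addrCA lerDl addr_ge0//.
  by apply: sumr_ge0 => i _; rewrite divr_ge0 ?ltW.
apply: (@le_trans _ _ 1); last by rewrite lerDl.
rewrite ler_pdivrMr// mul1r h//.
case: (leP 0 p0) => [p00|p00]; last by rewrite (le_trans (ltW p00)).
have /andP[_ /ltW/le_trans->//] := truncn_itv p00.
by rewrite ler_nat.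
Qed.

Lemma MseqE tau p : (0 < p)%N ->
  Mseq tau sigma p = expR (tau * (p%:R * p%:R `^ (sigma - 1)) * ln p%:R).
Proof. by move=> p0; rewrite -ln_Mseq// lnK ?posrE// Mseq_gt0. Qed.

(* In the Young conjugate take [t = w e^w] with [e^(b w) = H p / 2]. *)
Lemma Mseq_le_Nseq tau H : 0 < H -> 0 < tau ->
  4 * tau <= (sigma - 1) * (H / 2) `^ (sigma - 1) ->
  exists2 C : R, 1 <= C & forall p, Mseq tau sigma p <= C * Nseq H sigma p.
Proof.
move=> H0 tau0 tauH.
(* With [q = H p / 2], the bound [p >= 4 / H] gives [q >= 2], and [p >= 4 / H^2] gives [p <= q^2],
   hence [ln p <= 2 ln q]. *)
apply: (@le_mulr_of_eventually _ _ (Num.max 1 (Num.max (4 / H) (4 / H ^+ 2)))).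
- by move=> p; exact: Mseq_gt0.
- by move=> p; exact: Nseq_gt0.
move=> p; rewrite !ge_max => /and3P[p1 p2 p3].
have pR0 : (0 : R) < p%:R by lra.
have p0 : (0 < p)%N by rewrite -(ltr0n R).
set q := H / 2 * p%:R.
have q2 : 2 <= q by move: p2; rewrite ler_pdivrMr// /q; lra.
have q0 : 0 < q by lra.
have lq0 : 0 < ln q by rewrite ln_gt0//; lra.
have lqp : ln p%:R <= 2 * ln q.
  have -> : 2 * ln q = ln (q ^+ 2) by rewrite lnXn // mulr_natl.
  rewrite ler_ln ?posrE ?exprn_gt0//; try lra.
  move: p3; rewrite ler_pdivrMr ?exprn_gt0// => p3.
  have -> : q ^+ 2 = (p%:R * H ^+ 2) / 4 * p%:R by rewrite /q; field.
  by rewrite ler_peMl; lra.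
pose w := a * ln q; have w0 : 0 < w by rewrite mulr_gt0.
have t0 : 0 < w * expR w by rewrite mulr_gt0// expR_gt0.
have Hp0 : 0 <= H * p%:R by rewrite mulr_ge0// ltW.
rewrite MseqE// ler_expR ler_pdivlMl//; apply: le_trans (young_conj_ge Hp0 t0).
rewrite phi_mul_expR ?(ltW w0)// -/b /w.
have -> : expR (b * (a * ln q)) = q.
  by rewrite mulrA (mulrC b) ab1 mul1r lnK// posrE; lra.
have -> : expR (a * ln q) = (H / 2) `^ a * p%:R `^ a.
  by rewrite -powRM ?divr_ge0 ?(ltW H0)// mulrC expRM lnK// posrE; lra.
rewrite -/a.
have Q0 : 0 <= p%:R `^ a :> R by exact: powR_ge0.
set P := p%:R `^ a in Q0 *; set G := (H / 2) `^ a in tauH *.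
(* At the chosen [t], [phi t = t q] is exactly half of [H p t]. *)
have -> : H * p%:R * (a * ln q * (G * P)) - a * ln q * (G * P) * q =
  (H * p%:R * P) * (a * G * ln q / 2) by rewrite /q; field.
have -> : H * (tau * (p%:R * P) * ln p%:R) = (H * p%:R * P) * (tau * ln p%:R) by ring.
rewrite ler_wpM2l ?mulr_ge0 ?(ltW H0)//.
apply: (@le_trans _ _ (tau * (2 * ln q))); first by rewrite ler_wpM2l// ltW.
have : 4 * tau * ln q <= a * G * ln q := ler_wpM2r (ltW lq0) tauH.
lra.
Qed.

(* [H p t - phi t] is positive only if [e^(b W(t)) < H p], which bounds [t]. *)
Lemma Nseq_le_Mseq tau H : 0 < H -> 0 < tau ->
  2 * (sigma - 1) * H `^ (sigma - 1) <= tau ->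
  exists2 C : R, 1 <= C & forall p, Nseq H sigma p <= C * Mseq tau sigma p.
Proof.
move=> H0 tau0 tauH.
(* The bound [p >= H] gives [ln (H p) <= 2 ln p], and [p >= 1 / H] gives [ln (H p) >= 0]. *)
apply: (@le_mulr_of_eventually _ _ (Num.max 1 (Num.max H H^-1))).
- by move=> p; exact: Nseq_gt0.
- by move=> p; exact: Mseq_gt0.
move=> p; rewrite !ge_max => /and3P[p1 p2 p3].
have pR0 : (0 : R) < p%:R by lra.
have p0 : (0 < p)%N by rewrite -(ltr0n R).
set q := H * p%:R.
have q0 : 0 < q by rewrite mulr_gt0.
have lq0 : 0 <= ln q.
  by rewrite ln_ge0// /q -ler_pdivrMl// mulr1.
have lp0 : 0 <= ln p%:R :> R by rewrite ln_ge0.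
have lqp : ln q <= 2 * ln p%:R.
  by rewrite /q lnM ?posrE// mulr_natl mulr2n lerD2r ler_ln ?posrE.
rewrite MseqE// ler_expR ler_pdivrMl//.
have rhs0 : 0 <= H * (tau * (p%:R * p%:R `^ (sigma - 1)) * ln p%:R).
  by rewrite !mulr_ge0 ?powR_ge0// ltW.
apply: young_conj_le => t t0; rewrite phiE ?(ltW t0)// -/b -/q.
case: (leP q (expR (b * lambertW t))) => hq.
  by apply: le_trans rhs0; rewrite mulrC -mulrBr pmulr_rle0// subr_le0.
have wt : lambertW t <= a * ln q.
  rewrite -[leLHS]mul1r -ab1 -mulrA ler_pM2l// -ler_expR lnK ?posrE//; exact: ltW.
have tb : t <= a * ln q * (H `^ a * p%:R `^ a).
  have -> : H `^ a * p%:R `^ a = expR (a * ln q).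
    by rewrite -powRM ?(ltW H0)// [a * _]mulrC expRM lnK// posrE.
  rewrite -[leLHS](lambertWK (ltW t0)) ler_pM ?lambertW_ge0 ?expR_ge0//.
  by rewrite ler_expR.
apply: (@le_trans _ _ (q * t)); first by rewrite gerBl mulr_ge0 ?expR_ge0// ltW.
apply: (@le_trans _ _ (q * (a * ln q * (H `^ a * p%:R `^ a)))); first by rewrite ler_pM2l.
rewrite -/a /q.
have -> : H * (tau * (p%:R * p%:R `^ a) * ln p%:R) =
  H * p%:R * (p%:R `^ a * (tau * ln p%:R)) by ring.
have -> : H * p%:R * (a * ln (H * p%:R) * (H `^ a * p%:R `^ a)) =
  H * p%:R * (p%:R `^ a * (a * H `^ a * ln (H * p%:R))) by ring.
rewrite ler_pM2l// ler_wpM2l ?powR_ge0// -/q.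
apply: (@le_trans _ _ (a * H `^ a * (2 * ln p%:R))).
  by rewrite ler_wpM2l// mulr_ge0 ?powR_ge0// ltW.
by have := ler_wpM2r lp0 tauH; rewrite -/a; lra.
Qed.

End WeightMatrixComparison.

(** * Continuous inclusions and their passage to limits *)

Section LcsOrder.
Context {R : realType} {X : Type}.
Implicit Types E F G : lcs R X.

(* The identity is a continuous inclusion of [E] into [F]. *)
Definition lcs_le E F : Prop :=
  carrier E `<=` carrier F /\ nbhs0 F `<=` nbhs0 E.

Lemma lcs_le_anti E F : lcs_le E F -> lcs_le F E -> E = F.
Proof.
case: E F => [C1 N1] [C2 N2] [/= c12 n21] [/= c21 n12].
by congr Lcs; apply/seteqP.
Qed.

Lemma indlim_le (I J : Type) (D : set I) (D' : set J) (E : I -> lcs R X)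
    (F : J -> lcs R X) :
  (forall i, D i -> exists2 j, D' j & lcs_le (E i) (F j)) ->
  lcs_le (indlim D E) (indlim D' F).
Proof.
move=> h; split=> [f [i /h[j D'j [EF _]] /EF Ff]|W [V Vc [VW hV]]].
  by exists j.
exists V => //; split=> // i /h[j D'j [_ FE]]; exact/FE/hV.
Qed.

(** Any filter containing the generators for [E] contains those for [F]: the larger carrier by
    upward closure, and each neighbourhood for [F j] as one for a suitable [E i]. *)
Lemma projlim_le (A : set (X -> R[i])) (I J : Type) (D : set I) (D' : set J)
    (E : I -> lcs R X) (F : J -> lcs R X) :
  (forall j, D' j -> exists2 i, D i & lcs_le (E i) (F j)) ->
  lcs_le (projlim A D E) (projlim A D' F).
Proof.
move=> h.
have EF : A `&` \bigcap_(i in D) carrier (E i) `<=`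
    A `&` \bigcap_(j in D') carrier (F j).
  by move=> f [Af Ef]; split=> // j /h[i Di [c _]]; exact/c/Ef.
split=> //= V FV G [Gf EG]; apply: FV; split=> // W [->|[j /h[i Di [_ n]] /n EW]].
  by apply: filterS EF _; apply: EG; left.
by apply: EG; right; exists i.
Qed.

Lemma normed_lcs_le (A : set (X -> R[i])) (N N' : (X -> R[i]) -> \bar R) (C : R) :
  0 < C -> (forall f (e : R), 0 < e -> (N f < e%:E)%E -> (N' f <= (C * e)%:E)%E) ->
  lcs_le (normed_lcs A N) (normed_lcs A N').
Proof.
move=> C0 h.
have NN' : A `&` [set f | (N f < +oo)%E] `<=` A `&` [set f | (N' f < +oo)%E].
  move=> f [Af /= Nf]; split=> //=.
  (* The value [-oo], which a supremum over an empty set takes, is covered by [e = 1]. *)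
  have [e [e0 Ne]] : exists e : R, 0 < e /\ (N f < e%:E)%E.
    case: (N f) Nf => [r| |]// _.
      exists (`|r| + 1); split; first by rewrite ltr_wpDl.
      by rewrite lte_fin; have := ler_norm r; lra.
    by exists 1; rewrite ltr01 ltNye.
  by apply: le_lt_trans (h _ _ e0 Ne) _; rewrite ltry.
(* The extra factor 2 turns the weak bound [C e] into a strict one. *)
split=> // V [e /= e0 eV]; exists (e / (2 * C)) => /=.
  by rewrite divr_gt0// mulr_gt0.
move=> f [/NN' Bf /= Nf]; apply: eV; split=> //=.
have ce0 : 0 < e / (2 * C) by rewrite divr_gt0// mulr_gt0.
apply: le_lt_trans (h _ _ ce0 Nf) _; rewrite lte_fin.
have -> : C * (e / (2 * C)) = e / 2 by field; rewrite gt_eqF.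
lra.
Qed.

End LcsOrder.

(** * From sequence inequalities to inclusions of normed spaces *)

Section Spaces.
Context {R : realType} {d : nat}.
Implicit Types K U : set 'rV[R]_d.

Lemma weighted_norm_le K (c c' : nat -> R) (C : R) : 0 <= C ->
  (forall n, c' n <= C * c n) ->
  forall f (e : R), (weighted_norm K c f < e%:E)%E ->
  (weighted_norm K c' f <= (C * e)%:E)%E.
Proof.
move=> C0 h f e /ltW/ereal_supP he; apply/ereal_supP => _ [ax Kax <-].
have {}he := he _ (ex_intro2 _ _ ax Kax erefl).
rewrite lee_fin in he; rewrite lee_fin.
have normc_ge0 (z : R[i]) : 0 <= ComplexField.Normc.normc z.
  by case: z => x y; exact: sqrtr_ge0.
apply: le_trans (ler_wpM2l (normc_ge0 _) (h _)) _.
by rewrite mulrCA ler_wpM2l.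
Qed.

Lemma expRN_young_conj (H sigma : R) (n : nat) :
  expR (- (H^-1 * young_conj (phi sigma) (H * n%:R))) = (Nseq H sigma n)^-1.
Proof. by rewrite expRN. Qed.

Lemma EK_le_BK (sigma tau H C : R) K : 0 < C ->
  (forall p, Mseq tau sigma p <= C * Nseq H sigma p) ->
  lcs_le (EK sigma K tau) (BK sigma K H).
Proof.
move=> C0 h; apply: (normed_lcs_le _ C0) => f e _.
apply: weighted_norm_le; first exact: ltW.
move=> n; rewrite expRN_young_conj ler_pdivlMr ?Mseq_gt0//.
by rewrite mulrC ler_pdivrMr ?Nseq_gt0.
Qed.

Lemma BK_le_EK (sigma tau H C : R) K : 0 < C ->
  (forall p, Nseq H sigma p <= C * Mseq tau sigma p) ->
  lcs_le (BK sigma K H) (EK sigma K tau).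
Proof.
move=> C0 h; apply: (normed_lcs_le _ C0) => f e _.
apply: weighted_norm_le; first exact: ltW.
move=> n; rewrite expRN_young_conj ler_pdivlMr ?Nseq_gt0//.
by rewrite mulrC ler_pdivrMr ?Mseq_gt0.
Qed.

End Spaces.

(** * Choice of indices, equivalence of the matrices, equality of the spaces *)

Section Comparison.
Context {R : realType}.
Variable sigma : R.
Hypothesis sigma_gt1 : 1 < sigma.
Let a := sigma - 1.

Let a_gt0 : 0 < a. Proof. by rewrite subr_gt0. Qed.

(** Here and in the next three lemmas the index is chosen so that the condition of the comparison
    lemma holds with equality. *)
Lemma exists_tau_Mseq_le (H : R) : 0 < H -> exists2 tau, 0 < tau &
  exists2 C : R, 1 <= C & forall p, Mseq tau sigma p <= C * Nseq H sigma p.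
Proof.
move=> H0; exists (a * (H / 2) `^ a / 4).
  by rewrite divr_gt0// mulr_gt0// powR_gt0// divr_gt0.
apply: Mseq_le_Nseq => //; first by rewrite divr_gt0// mulr_gt0// powR_gt0// divr_gt0.
by rewrite mulrC divfK.
Qed.

Lemma exists_H_Mseq_le (tau : R) : 0 < tau -> exists2 H, 0 < H &
  exists2 C : R, 1 <= C & forall p, Mseq tau sigma p <= C * Nseq H sigma p.
Proof.
move=> tau0; have q0 : 0 < 4 * tau / a by rewrite divr_gt0// mulr_gt0.
exists (2 * (4 * tau / a) `^ a^-1); first by rewrite mulr_gt0// powR_gt0.
apply: Mseq_le_Nseq => //; first by rewrite mulr_gt0// powR_gt0.
rewrite -/a [2 * _]mulrC mulfK// -powRrM mulVf ?gt_eqF// powRr1 ?(ltW q0)//.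
by rewrite [a * _]mulrC divfK// gt_eqF.
Qed.

Lemma exists_tau_Nseq_le (H : R) : 0 < H -> exists2 tau, 0 < tau &
  exists2 C : R, 1 <= C & forall p, Nseq H sigma p <= C * Mseq tau sigma p.
Proof.
move=> H0; have t0 : 0 < 2 * a * H `^ a by rewrite !mulr_gt0// powR_gt0.
by exists (2 * a * H `^ a) => //; apply: Nseq_le_Mseq.
Qed.

Lemma exists_H_Nseq_le (tau : R) : 0 < tau -> exists2 H, 0 < H &
  exists2 C : R, 1 <= C & forall p, Nseq H sigma p <= C * Mseq tau sigma p.
Proof.
move=> tau0; have q0 : 0 < tau / (2 * a) by rewrite divr_gt0// mulr_gt0.
exists ((tau / (2 * a)) `^ a^-1); first by rewrite powR_gt0.
apply: Nseq_le_Mseq => //; first by rewrite powR_gt0.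
rewrite -/a -powRrM mulVf ?gt_eqF// powRr1 ?(ltW q0)//.
by rewrite mulrC divfK// gt_eqF// mulr_gt0.
Qed.

Lemma weight_matrix_Mmatrix : weight_matrix (Mmatrix sigma).
Proof.
split=> [_ [tau /= tau0 <-]|_ _ [tau /= tau0 <-] [tau' /= tau'0 <-]].
  exact: weight_sequence_Mseq.
by case: (leP tau tau') => [tt|/ltW tt]; [left|right] => p; exact: le_Mseq.
Qed.

Lemma weight_matrix_Nmatrix : weight_matrix (Nmatrix sigma).
Proof.
split=> [_ [H /= H0 <-]|_ _ [H /= H0 <-] [H' /= H'0 <-]].
  exact: weight_sequence_Nseq.
by case: (leP H H') => [tt|/ltW tt]; [left|right] => p; exact: le_Nseq.
Qed.

(** A constant [C >= 1] is at most [C^p] for [p >= 1]; index 0 has to be compared separately. *)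
Lemma ler_mul_exprn (M N : nat -> R) (C : R) : 1 <= C -> M 0%N <= N 0%N ->
  (forall p, 0 < N p) -> (forall p, M p <= C * N p) -> forall p, M p <= C ^+ p * N p.
Proof.
move=> C1 M0 N0 h [|p]; first by rewrite expr0 mul1r.
by apply: le_trans (h _) _; rewrite ler_pM2r// ler_eXnr.
Qed.

Lemma matrix_equiv_Mmatrix_Nmatrix : matrix_equiv (Mmatrix sigma) (Nmatrix sigma).
Proof.
split=> _ [s /= s0 <-].
- have [H H0 [C C1 h]] := exists_H_Mseq_le s0.
  exists (Nseq H sigma), C; split; [by exists H|by lra|].
  by apply: ler_mul_exprn => //; [rewrite Nseq0|move=> p; exact: Nseq_gt0].
- have [tau tau0 [C C1 h]] := exists_tau_Nseq_le s0.
  exists (Mseq tau sigma), C; split; [by exists tau|by lra|].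
  by apply: ler_mul_exprn => //; [rewrite Nseq0|move=> p; exact: Mseq_gt0].
Qed.

(** Projective limits need a source index for every target index; the inductive limits in the
    Roumieu case need a target index for every source index. *)
Lemma B_beurling_eq d (U : set 'rV[R]_d) : B_beurling sigma U = E_beurling sigma U.
Proof.
apply: lcs_le_anti; apply: projlim_le => K UK; exists K => //; apply: projlim_le.
- move=> tau /exists_H_Nseq_le[H H0 [C C1 h]]; exists H => //.
  by apply: BK_le_EK h; lra.
- move=> H /exists_tau_Mseq_le[tau tau0 [C C1 h]]; exists tau => //.
  by apply: EK_le_BK h; lra.
Qed.

Lemma B_roumieu_eq d (U : set 'rV[R]_d) : B_roumieu sigma U = E_roumieu sigma U.
Proof.
apply: lcs_le_anti; apply: projlim_le => K UK; exists K => //; apply: indlim_le.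
- move=> H /exists_tau_Nseq_le[tau tau0 [C C1 h]]; exists tau => //.
  by apply: BK_le_EK h; lra.
- move=> tau /exists_H_Mseq_le[H H0 [C C1 h]]; exists H => //.
  by apply: EK_le_BK h; lra.
Qed.

End Comparison.

Theorem theorem3p1 (R : realType) (sigma : R) (hsigma : 1 < sigma) :
  (equivalent_to_weight_function (fun k : R => phi sigma (ln_plus `|k|)) /\
   forall h tau : R, 0 < h -> 0 < tau ->
     equivalent_to_weight_function (fun k : R => Tfun tau sigma h `|k|)) /\
  ([/\ weight_matrix (Mmatrix sigma),
       weight_matrix (Nmatrix sigma)
     & matrix_equiv (Mmatrix sigma) (Nmatrix sigma)] /\
   forall (d : nat) (U : set 'rV[R]_d), open U ->
     B_beurling sigma U = E_beurling sigma U /\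
     B_roumieu sigma U = E_roumieu sigma U).
Proof.
have wphi := weight_function_phi hsigma.
split; split.
- exists (fun k => phi sigma (ln_plus `|k|)); split => //; exact: equiv_fun_refl.
- move=> h tau h0 tau0; exists (fun k => phi sigma (ln_plus `|k|)); split => //.
  exact: equiv_fun_Tfun.
- split; [exact: weight_matrix_Mmatrix|exact: weight_matrix_Nmatrix|].
  exact: matrix_equiv_Mmatrix_Nmatrix.
- by move=> d U _; split; [exact: B_beurling_eq|exact: B_roumieu_eq].
Qed.
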